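(* Let $d\ge2$. For each $\alpha>0$ there exists $p'(\alpha)\in(p_c(d),1)$ such that for every $p\in(p'(\alpha),1]$, \[ \limsup_{\|x\|_1\to+\infty,\ x\in\mathbb{Z}^d}\frac{\ln\mathbb{P}_p\big(0\leftrightarrow x,\ D(0,x)\ge(1+\alpha)\|x\|_1\big)}{\|x\|_1}<0. \]
   Context: Bernoulli bond percolation on $\mathbb{Z}^d$: $\mathbb{E}^d$ is the set of edges between points of $\mathbb{Z}^d$ at Euclidean distance $1$; $\mathbb{P}_p=(p\delta_1+(1-p)\delta_0)^{\otimes\mathbb{E}^d}$ on $\{0,1\}^{\mathbb{E}^d}$, an edge $e$ being open if $\omega(e)=1$. $p_c(d)$ is the critical probability of bond percolation on $\mathbb{Z}^d$. A path is a sequence of successive nearest neighbours; its length is its number of edges; it is open if all its edges are open. $x\leftrightarrow y$ means that $x$ and $y$ are joined by an open path. The chemical distance $D(x,y)$ is the minimal length of an open path from $x$ to $y$ ($+\infty$ if none). $\|x\|_1=\sum_i|x_i|$. *)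

(* Defs.v *)
From HB Require Import structures.
From mathcomp Require Import all_boot all_order all_algebra.
From mathcomp Require Import all_classical all_reals all_analysis.
Set Implicit Arguments. Unset Strict Implicit. Unset Printing Implicit Defensive.
Import Order.TTheory GRing.Theory Num.Theory.
Local Open Scope classical_set_scope.
Local Open Scope ring_scope.

Definition vertex (d : nat) := {ffun 'I_d -> int}.

Definition origin (d : nat) : vertex d := [ffun _ => 0].

Definition shift (d : nat) (x : vertex d) (i : 'I_d) (s : int) : vertex d :=
  [ffun j => x j + (if j == i then s else 0)].

Definition norm1 (d : nat) (x : vertex d) : nat := (\sum_(i < d) `|x i|)%N.

(* The edge set E^d: the pair (x, i) encodes the edge {x, x + e_i};
   this is a bijection onto the set of nearest-neighbour edges. *)
Definition edge (d : nat) := (vertex d * 'I_d)%type.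

(* Configurations omega in {0,1}^{E^d} (true = open). *)
Definition config (d : nat) := edge d -> bool.

Definition open_adj (d : nat) (om : config d) : rel (vertex d) :=
  fun y z => [exists i : 'I_d,
    ((z == shift y i 1) && om (y, i)) || ((y == shift z i 1) && om (z, i))].

Definition open_path (d : nat) (om : config d) (x y : vertex d) (n : nat) : Prop :=
  exists s : seq (vertex d), size s = n /\ path (open_adj om) x s /\ last x s = y.

Definition joined (d : nat) (om : config d) (x y : vertex d) : Prop :=
  exists n, open_path om x y n.

(* chemical distance D(x,y) (+oo if no open path) *)
Definition chem_dist (R : realType) (d : nat) (om : config d) (x y : vertex d)
  : \bar R := ereal_inf [set (n%:R)%:E | n in [set n | open_path om x y n]].

Definition percolates (d : nat) (om : config d) : Prop :=
  ~ finite_set [set y | joined om (origin d) y].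

(* (P, om) realises Bernoulli bond percolation P_p on Z^d: om : T -> {0,1}^{E^d}
   has measurable coordinates, and its finite-dimensional distributions are those
   of the product measure (p delta_1 + (1-p) delta_0)^{\otimes E^d}.
   (These determine the law of om, i.e. om is distributed as P_p.) *)
Definition bernoulli_bond (R : realType) (d : nat) (p : R)
  (d0 : measure_display) (T : measurableType d0) (P : probability T R)
  (om : T -> config d) : Prop :=
  (forall e : edge d, measurable [set t | om t e]) /\
  (forall (F : seq (edge d)) (a : edge d -> bool), uniq F ->
     P [set t | forall e, e \in F -> om t e = a e]
     = (\prod_(e <- F) (if a e then p else 1 - p))%:E).

Definition no_percolation (R : realType) (d : nat) (p : R) : Prop :=
  forall (d0 : measure_display) (T : measurableType d0) (P : probability T R)
    (om : T -> config d),
    bernoulli_bond p P om -> P [set t | percolates (om t)] = 0%E.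

Definition p_c (R : realType) (d : nat) : R :=
  sup [set p : R | 0 <= p <= 1 /\ no_percolation d p].

(* Main.v *)
Require Import Defs.
From HB Require Import structures.
From mathcomp Require Import all_boot all_order all_algebra.
From mathcomp Require Import all_classical all_reals all_analysis.
From mathcomp Require Import measurable_realfun.
From mathcomp Require Import zify ring lra.
Set Implicit Arguments. Unset Strict Implicit. Unset Printing Implicit Defensive.
Import Order.TTheory GRing.Theory Num.Theory.
Local Open Scope classical_set_scope.
Local Open Scope ring_scope.

(** Call two edges close when their base points are at sup-distance at most 1, and let
    [K] be a set of closed edges containing every closed edge of a geodesic from [0] to
    [x] and every closed edge close to [K].  If [0] and [x] are joined by a path avoiding
    [K], they are joined by an open path made of edges of the geodesic and of edges close
    to [K].  Indeed, if [A] is the set of vertices reached from [0] by such paths, the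
    edges of [K] in the boundary of [A] form a mod 2 cocycle, hence a coboundary [d psi];
    [psi] takes the same value at [0] and [x] because of the path avoiding [K], and
    [A + psi] does because of the geodesic, so that [x] lies in [A].

    So [D(0,x) <= |x| + C |K|].  A breadth-first exploration of the closed edges, encoded
    by bit masks, shows that the probability that [K] cannot be chosen with fewer than
    [m] edges is at most [2^|x| (2^B (1 - p))^m], and [m] is taken to be a small multiple
    of [|x|].

    The bound [p_c < 1] uses the same detour argument: the segment from [0] to [n e_1] is
    compared with the other three sides of a square, which avoid [K] unless the closed
    cluster of some edge of the segment is at least as large as its distance to the nearer
    end point.  Since [no_percolation] quantifies over the realizations of the model, this
    also requires one to exist, which the digits of a uniform variable provide. *)

(* The topology library has another [shift]. *)
Local Notation shift := Defs.shift.

(** * Open paths *)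

Section OpenPaths.
Variable d : nat.
Implicit Types (v x y z : vertex d) (i j : 'I_d) (e : edge d) (om : config d).
Implicit Types (E : seq (edge d)) (V : seq (vertex d)).

Lemma shiftC v i j s t : shift (shift v i s) j t = shift (shift v j t) i s.
Proof. by apply/ffunP => k; rewrite !ffunE addrAC. Qed.

Lemma shiftD v i s t : shift (shift v i s) i t = shift v i (s + t).
Proof. by apply/ffunP => k; rewrite !ffunE -addrA; case: ifP; rewrite ?addr0. Qed.

Lemma shift0 v i : shift v i 0 = v.
Proof. by apply/ffunP => k; rewrite !ffunE if_same addr0. Qed.

Lemma shift_same v i s : shift v i s i = v i + s.
Proof. by rewrite ffunE eqxx. Qed.

Lemma shift_other v i j s : j != i -> shift v i s j = v j.
Proof. by rewrite ffunE => /negbTE ->; rewrite addr0. Qed.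

Definition head_of e : vertex d := shift e.1 e.2 1.

Definition edge_joins e y z : bool :=
  ((y, z) == (e.1, head_of e)) || ((z, y) == (e.1, head_of e)).

Lemma edge_joinsC e y z : edge_joins e y z = edge_joins e z y.
Proof. by rewrite /edge_joins orbC. Qed.

Lemma edge_joins_tail e : edge_joins e e.1 (head_of e).
Proof. by rewrite /edge_joins eqxx. Qed.

Lemma open_adjP om y z :
  reflect (exists2 e, edge_joins e y z & om e) (open_adj om y z).
Proof.
apply: (iffP existsP) => [[i /orP[/andP[/eqP-> oe]|/andP[/eqP-> oe]]]|[[v i]]].
- by exists (y, i); rewrite ?edge_joins_tail.
- by exists (z, i); rewrite // edge_joinsC edge_joins_tail.
by move=> /orP[] /eqP[-> ->] oe; exists i; rewrite eqxx oe ?orbT.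
Qed.

Lemma open_adj_sym om y z : open_adj om y z = open_adj om z y.
Proof. by apply/existsP/existsP => -[i h]; exists i; rewrite orbC. Qed.

Lemma joinedP om x y :
  joined om x y <-> exists2 s, last x s = y & path (open_adj om) x s.
Proof.
by split=> [[n [s [_ [? ?]]]]|[s ? ?]]; [exists s | exists (size s), s].
Qed.

Lemma open_path_rcons om x y z n :
  open_path om x y n -> open_adj om y z -> open_path om x z n.+1.
Proof.
move=> [s [sn [ps ls]]] yz; exists (rcons s z).
by rewrite size_rcons sn rcons_path ps ls last_rcons.
Qed.

Lemma open_path_sub om om' x y n :
  (forall e, om e -> om' e) -> open_path om x y n -> open_path om' x y n.
Proof.
move=> sub [s [sn [ps ls]]]; exists s; split=> //; split=> //.
by apply: sub_path ps => u v /open_adjP[e je oe]; apply/open_adjP; exists e => //; apply: sub.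
Qed.

Lemma joined_refl om x : joined om x x.
Proof. by exists 0%N, [::]. Qed.

Lemma joined_step om x y z : joined om x y -> open_adj om y z -> joined om x z.
Proof. by move=> [n pn] yz; exists n.+1; apply: open_path_rcons yz. Qed.

Lemma joined_edge om e y z : om e -> edge_joins e y z -> joined om y z.
Proof. by move=> oe je; apply: joined_step (joined_refl om y) _; apply/open_adjP; exists e. Qed.

Lemma joined_sub om om' x y :
  (forall e, om e -> om' e) -> joined om x y -> joined om' x y.
Proof. by move=> sub [n /(open_path_sub sub) pn]; exists n. Qed.

Lemma joined_trans om y x z : joined om x y -> joined om y z -> joined om x z.
Proof.
move=> /joinedP[s ls ps] /joinedP[s' ls' ps']; apply/joinedP; exists (s ++ s').
  by rewrite last_cat ls.
by rewrite cat_path ps ls.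
Qed.

Lemma joined_sym om x y : joined om x y -> joined om y x.
Proof.
move=> /joinedP[s <- ps]; elim: s x ps => [x _|z s IHs x /= /andP[xz /IHs zy]].
  exact: joined_refl.
by apply: joined_step zy _; rewrite open_adj_sym.
Qed.

Lemma joined_line om x i n :
  (forall k, (k < n)%N -> om (shift x i k%:Z, i)) -> joined om x (shift x i n%:Z).
Proof.
elim: n => [|n IHn] omx; first by rewrite shift0; apply: joined_refl.
apply: joined_trans (IHn (fun k ltkn => omx k (ltnW ltkn))) _.
apply: joined_edge (omx n (leqnn _)) _; rewrite -addn1 PoszD -shiftD.
exact: edge_joins_tail.
Qed.

Lemma norm1_eq0 x : norm1 x = 0%N -> x = origin d.
Proof.
move=> /eqP; rewrite sum_nat_eq0 => /forallP x0; apply/ffunP => i; rewrite ffunE.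
by apply/eqP; rewrite -absz_eq0; apply: x0.
Qed.

Lemma norm1_shift x i s : (norm1 (shift x i s) + `|x i| = norm1 x + `|(x i + s)%R|)%N.
Proof.
rewrite /norm1 (bigD1 i) //= [in RHS](bigD1 i) //= shift_same.
rewrite (eq_bigr (fun k => `|x k|%N)).
  by rewrite addnAC [RHS]addnAC [X in (X + _)%N = _]addnC.
by move=> k neki; rewrite shift_other.
Qed.

Lemma open_path_norm1 x : open_path (fun=> true) (origin d) x (norm1 x).
Proof.
move nE : (norm1 x) => n; elim: n x nE => [|n IHn] x nE.
  by rewrite (norm1_eq0 nE); exists [::].
have [i xi] : exists i, x i != 0.
  apply/existsP; apply: contra_eqT nE => /existsPn x0.
  by rewrite /norm1 big1 // => i _; have /negPn/eqP -> := x0 i.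
pose s : int := if 0 < x i then -1 else 1.
have /IHn /open_path_rcons : norm1 (shift x i s) = n.
  by have := norm1_shift x i s; rewrite /s; case: ifP; lia.
apply; apply/existsP; exists i; rewrite /s; case: ifP => _.
  by rewrite shiftD subrr shift0 eqxx.
by rewrite eqxx orbT.
Qed.

Definition supported_on om V : Prop :=
  forall e, om e -> e.1 \in V /\ head_of e \in V.

Lemma edge_joins_supported om V e y z :
  supported_on om V -> om e -> edge_joins e y z -> z \in V.
Proof. by move=> omV /omV[tV hV] /orP[/eqP[_ ->]|/eqP[-> _]]. Qed.

Lemma open_path_edges om x y n : open_path om x y n ->
  exists E V, [/\ size E = n, size V = n.+1, x \in V,
    supported_on [in E] V & joined [in E] x y].
Proof.
move=> [s [<- [ps <-]]]; elim: s x ps => [x _|z s IHs x /= /andP[xz /IHs]].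
  by exists [::], [:: x]; rewrite mem_head; split=> //; apply: joined_refl.
move=> [E [V [sE sV zV EV jE]]]; have /open_adjP[e je _] := xz.
exists (e :: E), (x :: V); rewrite /= sE sV mem_head; split=> //.
  move=> e'; rewrite !inE => /orP[/eqP->|/EV[-> ->]]; last by rewrite !orbT.
  by case/orP: je => /eqP[<- <-]; rewrite zV !eqxx !orbT.
apply: (@joined_trans _ z); first by apply: joined_edge je; apply: mem_head.
by apply: joined_sub jE => e' e'E; rewrite inE e'E orbT.
Qed.

Lemma open_path_short om V x y : x \in V -> supported_on om V ->
  joined om x y -> exists2 n, (n < size V)%N & open_path om x y n.
Proof.
move=> xV omV /joinedP[s ls ps].
case/shortenP: ps ls => s' ps' us' _ ls; exists (size s'); last by exists s'.
apply: (@uniq_leq_size _ (x :: s') V us') => z; rewrite inE => /orP[/eqP->//|].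
elim: s' x ps' {xV us' ls} => //= w s' IHs x /andP[/open_adjP[e je oe] /IHs IH].
by rewrite inE => /orP[/eqP->|/IH//]; exact: edge_joins_supported oe je.
Qed.

End OpenPaths.

(** * Cochains modulo 2 *)

Section Cochains.
Variable d : nat.
Implicit Types (v x y : vertex d) (i j k : 'I_d) (f g : edge d -> bool).
Implicit Types (phi psi : vertex d -> bool) (om : config d).

Definition coboundary phi (e : edge d) : bool := phi e.1 (+) phi (head_of e).

Definition cocycle f : Prop := forall v i j, i != j ->
  f (v, i) (+) f (shift v i 1, j) = f (v, j) (+) f (shift v j 1, i).

Lemma coboundaryD phi psi e :
  coboundary (fun v => phi v (+) psi v) e = coboundary phi e (+) coboundary psi e.
Proof. exact: addbACA. Qed.

Lemma cocycleD f g : cocycle f -> cocycle g -> cocycle (fun e => f e (+) g e).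
Proof. by move=> cf cg v i j nij; rewrite addbACA cf // cg // addbACA. Qed.

Lemma coboundary_cocycle phi : cocycle (coboundary phi).
Proof.
move=> v i j _; rewrite /coboundary /head_of /= (shiftC v i j).
by rewrite !addbA !addbK.
Qed.

Lemma coboundary_joined om phi x y :
  (forall e, om e -> coboundary phi e = false) -> joined om x y -> phi x = phi y.
Proof.
move=> phi0 /joinedP[s <- ps]; elim: s x ps => [//|z s IHs] x /= /andP[xz /IHs <-].
have /open_adjP[e je /phi0/eqP] := xz.
by rewrite eqbF_neg negb_add => /eqP eq_ends; case/orP: je => /eqP[-> ->].
Qed.

Definition primitive (u : int -> bool) (s : int) : bool :=
  match s with
  | Posz n => \big[addb/false]_(k < n) u k
  | Negz n => \big[addb/false]_(k < n.+1) u (Negz k)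
  end.

Lemma primitiveP u s : primitive u s (+) primitive u (s + 1) = u s.
Proof.
case: s => [n|[|n]].
- by rewrite -PoszD addn1 /= big_ord_recr /= addbA addbb.
- by rewrite /= big_ord_recr !big_ord0 /= addbF.
- have -> : Negz n.+1 + 1 = Negz n by lia.
  by rewrite /= [in X in X (+) _]big_ord_recr /= addbC addbA addbb.
Qed.

Definition set_coord v i (s : int) : vertex d := [ffun k => if k == i then s else v k].

Lemma set_coord_id v i : set_coord v i (v i) = v.
Proof. by apply/ffunP => k; rewrite ffunE; case: eqP => [->|]. Qed.

Lemma set_coord_shift v i s t : set_coord (shift v i t) i s = set_coord v i s.
Proof. by apply/ffunP => k; rewrite !ffunE; case: eqP => // _; rewrite addr0. Qed.

Lemma set_coord_shiftC v i k s t : i != k ->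
  set_coord (shift v i t) k s = shift (set_coord v k s) i t.
Proof.
move=> neik; apply/ffunP => j; rewrite !ffunE; case: (eqVneq j k) => // ->.
by rewrite eq_sym (negbTE neik) addr0.
Qed.

Lemma cocycle_integrate f k : cocycle f ->
    (forall v i, (i < k)%N -> f (v, i) = false) ->
  exists psi, forall v i, (i <= k)%N -> coboundary psi (v, i) = f (v, i).
Proof.
move=> cf f0; exists (fun v => primitive (fun s => f (set_coord v k s, k)) (v k)) => v i.
rewrite /coboundary /head_of /= leq_eqVlt => /orP[/eqP/val_inj -> | ltik].
  rewrite shift_same; under [in X in _ (+) X]eq_fun do rewrite set_coord_shift.
  by rewrite primitiveP set_coord_id.
have neik : i != k by rewrite neq_ltn ltik.
rewrite shift_other 1?eq_sym // f0 //.
rewrite [X in _ (+) primitive X _](_ : _ = fun s => f (set_coord v k s, k)) ?addbb //.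
apply/funext => s; rewrite set_coord_shiftC //.
by have := cf (set_coord v k s) i k neik; rewrite !(f0 _ i ltik) addFb addbF.
Qed.

Lemma poincare f : cocycle f -> exists phi, forall e, coboundary phi e = f e.
Proof.
move=> cf.
suff /(_ d (leqnn d)) [phi phiP] : forall n, (n <= d)%N ->
    exists phi, forall v i, (i < n)%N -> coboundary phi (v, i) = f (v, i).
  by exists phi => -[v i]; apply: phiP.
elim=> [_|n IHn ltnd]; first by exists (fun=> false).
have [phi phiP] := IHn (ltnW ltnd).
have [|v i ltin|psi psiP] :=
  @cocycle_integrate (fun e => f e (+) coboundary phi e) (Ordinal ltnd).
- by apply: cocycleD => //; apply: coboundary_cocycle.
- by rewrite phiP // addbb.
exists (fun v => phi v (+) psi v) => v i ltin.
by rewrite coboundaryD psiP // addbCA addbb addbF.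
Qed.

End Cochains.

(** * Detours around closed edges *)

Section Detours.
Variable d : nat.
Implicit Types (v x y : vertex d) (i j : 'I_d) (f om K route bypass : config d).

Definition close_edges (e e' : edge d) : bool := [forall k, `|e'.1 k - e.1 k| <= 1].

Definition closed_in om K : Prop := forall e, K e -> om e = false.

Definition saturated om K : Prop :=
  forall e e', K e -> close_edges e e' -> om e' = false -> K e'.

Definition square v i j : seq (edge d) :=
  [:: (v, i); (shift v i 1, j); (v, j); (shift v j 1, i)].

Lemma close_edges_square v i j : {in square v i j &, forall e e', close_edges e e'}.
Proof.
move=> e e'; rewrite !inE => /or4P[] /eqP -> /or4P[] /eqP ->; apply/forallP => k /=;
by rewrite ?ffunE; do 2?case: ifP => ?; lia.
Qed.

Lemma cocycle_restrict K f : cocycle f ->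
    (forall e e', K e -> close_edges e e' -> f e' -> K e') ->
  cocycle (fun e => K e && f e).
Proof.
move=> cf satK v i j nij.
have [/hasP[e esq Ke]|/hasPn noK] := boolP (has K (square v i j)).
  have KfE e' : e' \in square v i j -> K e' && f e' = f e'.
    move=> e'sq; case fe': (f e'); last by rewrite andbF.
    by rewrite (satK e e') //; apply: close_edges_square e'sq.
  by rewrite !KfE ?inE ?eqxx ?orbT //; apply: cf.
by rewrite !(negbTE (noK _ _)) ?inE ?eqxx ?orbT.
Qed.

Definition near_edges K : config d := fun e => `[< exists2 e', K e' & close_edges e' e >].

Lemma joined_detour om K route x y :
    closed_in om K -> saturated om K ->
    (forall e, route e -> om e = false -> K e) ->
    joined route x y -> joined (fun e => ~~ K e) x y ->
  joined (fun e => om e && (route e || near_edges K e)) x y.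
Proof.
move=> clK satK routeK jroute javoid; set om' := (X in joined X x y).
pose A z := `[< joined om' x z >].
have A_om' e : om' e -> coboundary A e = false.
  move=> oe; apply/negbTE; rewrite negb_add; apply/eqP/asbool_equiv_eq.
  have ends := joined_edge oe (edge_joins_tail e).
  by split=> jx; apply: joined_trans jx _ => //; apply: joined_sym.
have satA e e' : K e -> close_edges e e' -> coboundary A e' -> K e'.
  move=> Ke ee' Ae'; apply: (satK _ _ Ke ee'); apply: contraTF Ae' => oe'.
  by rewrite A_om' // /om' oe'; apply/orP; right; apply/asboolP; exists e.
have [psi psiP] := poincare (cocycle_restrict (coboundary_cocycle A) satA).
have psi_xy : psi x = psi y.
  by apply: coboundary_joined javoid => e nKe; rewrite psiP (negbTE nKe).
have : A x (+) psi x = A y (+) psi y.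
  apply: (@coboundary_joined _ route (fun z => A z (+) psi z)) jroute => e re.
  rewrite coboundaryD psiP; case Ke: (K e); first by rewrite addbb.
  rewrite addbF; apply: A_om'; rewrite /om' re andbT.
  by apply: contraFT Ke => /negbTE; apply: routeK.
rewrite psi_xy => /addIb Axy.
by apply/asboolP; rewrite -[asbool _]/(A y) -Axy; apply/asboolP/joined_refl.
Qed.

Definition enclosed om bypass (e : edge d) : Prop := exists K,
  [/\ K e, closed_in om K, saturated om K & forall e', K e' -> ~~ bypass e'].

Lemma joined_bypass om route bypass x y :
    (forall e, route e -> om e = false -> enclosed om bypass e) ->
    joined route x y -> joined bypass x y ->
  joined om x y.
Proof.
move=> route_enclosed jroute jbypass; pose K e := `[< enclosed om bypass e >].
have clK : closed_in om K by move=> e /asboolP[K' [K'e clK' _ _]]; apply: clK'.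
have satK : saturated om K.
  move=> e e' /asboolP[K' [K'e clK' satK' avoid]] ee' oe'; apply/asboolP.
  by exists K'; split=> //; apply: satK' ee' oe'.
have routeK e : route e -> om e = false -> K e.
  by move=> re oe; apply/asboolP/route_enclosed.
have avoidK : joined (fun e => ~~ K e) x y.
  apply: joined_sub jbypass => e be; apply/asboolPn => -[K' [K'e _ _ /(_ e K'e)]].
  by rewrite be.
by apply: joined_sub (joined_detour clK satK routeK jroute avoidK) => e /andP[].
Qed.

End Detours.

(** * Exploration of closed edges *)

Lemma mask_undup_filter (T : eqType) (a : pred T) (s : seq T) (n : nat) :
  size s = n -> exists m : n.-tuple bool, mask m s = undup [seq x <- s | a x].
Proof.
move=> <-; have /subseqP[m sm ->] : subseq (undup [seq x <- s | a x]) s.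
  exact: subseq_trans (undup_subseq _) (filter_subseq _ _).
by exists (Tuple (introT eqP sm)).
Qed.

Section Exploration.
Variable d : nat.
Implicit Types (e : edge d) (S K explored queue : seq (edge d)) (m : nat).

Definition branching : nat := (3 ^ d * d)%N.

Definition nbrs e : seq (edge d) :=
  [seq ([ffun k => e.1 k + ((u k)%:Z - 1)], j)
  | u : {ffun 'I_d -> 'I_3} <- enum {ffun 'I_d -> 'I_3}, j : 'I_d <- enum 'I_d].

Lemma size_nbrs e : size (nbrs e) = branching.
Proof. by rewrite size_allpairs -!cardE card_ffun !card_ord. Qed.

Lemma size_flatten_nbrs K : size (flatten (map nbrs K)) = (size K * branching)%N.
Proof. by elim: K => //= e K IHK; rewrite size_cat size_nbrs IHK mulSn. Qed.

Lemma mem_nbrs e e' : (e' \in nbrs e) = close_edges e e'.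
Proof.
apply/allpairsP/forallP => [[[u j] [_ _ ->]] k /=|close].
  by rewrite ffunE addrAC subrr add0r; case: (u k) => q lq /=; lia.
exists ([ffun k => inord `|(e'.1 k - e.1 k + 1)%R|%N], e'.2).
rewrite !mem_enum; split=> //=; case: e' close => v j /= close; congr pair.
apply/ffunP => k; rewrite !ffunE inordK; move: (close k); move: (v k) (e.1 k) => a b; lia.
Qed.

(* Breadth-first search in which the [n]-th mask prescribes the neighbours of the
   [n]-th explored edge that enter the queue. *)
Fixpoint explore (cs : seq (branching.-tuple bool)) explored queue : seq (edge d) :=
  match cs, queue with
  | c :: cs', e :: queue' => explore cs' (rcons explored e) (queue' ++ mask c (nbrs e))
  | _, _ => explored ++ queue
  end.

Definition code S m : finType :=
  ((size S).-tuple bool * m.-tuple (branching.-tuple bool))%type.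

Lemma card_code S m : #|code S m| = (2 ^ size S * (2 ^ branching) ^ m)%N.
Proof. by rewrite card_prod !card_tuple card_bool. Qed.

Definition decode S m (c : code S m) : seq (edge d) := explore c.2 [::] (mask c.1 S).

Definition large_exploration (om : config d) S m : Prop :=
  exists2 c : code S m, (m <= size (decode c))%N && uniq (decode c)
    & closed_in om [in decode c].

Section Dichotomy.
Variables (om : config d) (height : edge d -> nat).
Hypothesis height_close : forall e e', close_edges e e' -> (height e' <= (height e).+1)%N.

(* A 1-Lipschitz height vanishing on the initial edges stays below the number of edges
   found, which bounds how far the search extends. *)
Definition exploring explored queue : Prop :=
  [/\ uniq (explored ++ queue), closed_in om [in explored ++ queue],
    (forall e e', e \in explored -> close_edges e e' -> om e' = false ->
      e' \in explored ++ queue)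
    & {in explored ++ queue, forall e, (height e < size (explored ++ queue))%N}].

Lemma exploring_step explored e queue : exploring explored (e :: queue) ->
  exists c : branching.-tuple bool, exploring (rcons explored e) (queue ++ mask c (nbrs e)).
Proof.
pose s := explored ++ e :: queue; move=> [uniq_s closed_s sat_s height_s].
have [c cE] := mask_undup_filter (fun e' => ~~ om e' && (e' \notin s)) (size_nbrs e).
pose new := mask c (nbrs e).
have uniq_new : uniq new by rewrite /new cE undup_uniq.
have memE e' : (e' \in new) = [&& ~~ om e', e' \notin s & close_edges e e'].
  by rewrite /new cE mem_undup mem_filter mem_nbrs andbA.
have catE : rcons explored e ++ queue ++ new = s ++ new by rewrite catA cat_rcons.
exists c; split; rewrite catE.
- rewrite cat_uniq uniq_s uniq_new andbT; apply/hasPn => e'.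
  by rewrite memE => /and3P[].
- move=> e' /=; rewrite mem_cat memE => /orP[/closed_s//|/and3P[/negbTE//]].
- move=> e1 e2; rewrite mem_rcons inE mem_cat memE => /orP[/eqP->|e1_in] e12 oe2.
    by rewrite oe2 e12 andbT orbN.
  by rewrite (sat_s e1 e2).
- move=> e'; rewrite mem_cat size_cat => /orP[/height_s lt_s|e'_new].
    exact: leq_trans lt_s (leq_addr _ _).
  have := e'_new; rewrite memE => /and3P[_ _ /height_close].
  have : (0 < size new)%N by case: (new) e'_new.
  have : (height e < size s)%N by apply: height_s; rewrite mem_cat mem_head orbT.
  lia.
Qed.

Lemma explore_dichotomy m explored queue : exploring explored queue ->
  (exists2 cs : m.-tuple (branching.-tuple bool),
     (m + size explored <= size (explore cs explored queue))%N
       && uniq (explore cs explored queue)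
     & closed_in om [in explore cs explored queue]) \/
  (exists K, [/\ exploring K [::], {subset explored ++ queue <= K}
     & (size K < m + size explored)%N]).
Proof.
elim: m explored queue => [|m IHm] explored queue expl.
  have [uniq_s closed_s _ _] := expl.
  have explore0 : explore [tuple] explored queue = explored ++ queue by case: (queue).
  by left; exists [tuple]; rewrite explore0 // uniq_s size_cat leq_addr.
case: queue expl => [|e queue] expl.
  by right; exists explored; rewrite cats0 addSn ltnS leq_addl; split.
have [c /IHm] := exploring_step expl.
rewrite size_rcons addnS => -[[cs large closed_cs]|[K [explK subK ltK]]].
  by left; exists [tuple of c :: cs].
right; exists K; split=> // e'; rewrite -cat_rcons => e'_in; apply: subK.
by rewrite catA mem_cat e'_in.
Qed.

Lemma small_exploration S m :
    {in S, forall e, height e = 0%N} -> ~ large_exploration om S m ->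
  exists K, [/\ closed_in om [in K], saturated om [in K],
    {in S, forall e, om e = false -> e \in K}, (size K < m)%N
    & {in K, forall e, (height e < size K)%N}].
Proof.
move=> height_S not_large.
have [w wE] := mask_undup_filter (fun e => ~~ om e) (erefl (size S)).
have memE e : (e \in mask w S) = ~~ om e && (e \in S).
  by rewrite wE mem_undup mem_filter.
have expl : exploring [::] (mask w S).
  split=> //=; first by rewrite wE undup_uniq.
    by move=> e /=; rewrite memE => /andP[/negbTE].
  move=> e e_in; rewrite height_S; first by case: (mask _ _) e_in.
  by move: e_in; rewrite memE => /andP[].
have [[cs large closed_cs]|[K [[_ closed_K sat_K height_K] subK]]] := explore_dichotomy m expl.
  by exfalso; apply: not_large; exists (w, cs); rewrite ?addn0 in large *.
rewrite addn0 => ltK; rewrite !cats0 in closed_K sat_K height_K.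
exists K; split=> // e eS oe; apply: subK.
by rewrite memE oe.
Qed.

End Dichotomy.
End Exploration.

(** * Events and their probabilities *)

Section MeasureTheory.
Context d0 (T : measurableType d0) (R : realType).

Lemma countable_bigcup_measurable (U : countType) (D : set U) (F : U -> set T) :
  (forall u, D u -> measurable (F u)) -> measurable (\bigcup_(u in D) F u).
Proof.
move=> mF; rewrite bigcup_mkcond; apply: countable_bigcupT_measurable.
  exact: countableP.
by move=> u; case: ifPn => // /set_mem; apply: mF.
Qed.

Lemma countable_bigcap_measurable (U : countType) (D : set U) (F : U -> set T) :
  (forall u, D u -> measurable (F u)) -> measurable (\bigcap_(u in D) F u).
Proof.
move=> mF; rewrite -[X in measurable X]setCK setC_bigcap; apply: measurableC.
by apply: countable_bigcup_measurable => u Du; apply/measurableC/mF.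
Qed.

Lemma measure_bigcup_fin_le (mu : {measure set T -> \bar R}) (I : finType) (D : pred I)
    (F : I -> set T) : (forall i, D i -> measurable (F i)) ->
  (mu (\bigcup_(i in [set` D]) F i) <= \sum_(i | D i) mu (F i))%E.
Proof.
move=> mF; rewrite bigfs ?index_enum_uniq //; last by move=> i _; rewrite mem_index_enum.
apply: content_sub_fsum => //.
by apply: countable_bigcup_measurable.
Qed.

Lemma probability_setI1 (P : probability T R) (A B : set T) :
  measurable A -> measurable B -> P A = 1%E -> P (B `&` A) = P B.
Proof.
move=> mA mB PA; rewrite [RHS](measureDI P mB mA) [X in _ = (X + _)%E](_ : _ = 0%E) ?add0e //.
apply: (subset_measure0 (B := ~` A)); [exact: measurableD|exact: measurableC|by move=> t []|].
by rewrite [LHS](probability_setC P mA) PA subee.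
Qed.

Lemma le_probability_lim_sup_set (P : probability T R) (F : (set T)^nat) (r : \bar R) :
  (forall n, measurable (F n)) -> (forall n, (r <= P (F n))%E) -> (r <= P (lim_sup_set F))%E.
Proof.
move=> mF leF.
have /(lim_sup_set_cvg P F mF) cvF : (P (\bigcup_(k >= 0) F k) < +oo)%E.
  by rewrite ltey_eq fin_num_measure //; apply: bigcup_measurable.
rewrite -(cvg_lim _ cvF) //; apply: lime_ge; first by apply/cvg_ex; eexists; exact: cvF.
apply: nearW => n; apply: le_trans (leF n) _; apply: le_measure; rewrite ?inE //.
  by apply: bigcup_measurable => k _.
by apply: bigcup_sup => /=.
Qed.

End MeasureTheory.

Definition branching_rate (R : realType) (d : nat) (p : R) : R :=
  2 ^+ branching d * (1 - p).

Lemma branching_rate_ge0 (R : realType) (d : nat) (p : R) :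
  0 <= p <= 1 -> 0 <= branching_rate d p.
Proof. by move=> /andP[_ p_le1]; rewrite mulr_ge0 ?exprn_ge0 // subr_ge0. Qed.

Section Events.
Variables (R : realType) (d : nat) (p : R) (d0 : measure_display)
  (T : measurableType d0) (P : probability T R) (om : T -> config d).
Hypothesis omP : bernoulli_bond p P om.
Implicit Types (x y : vertex d) (L S : seq (edge d)) (m n : nat).

Lemma measurable_open_edge e : measurable [set t | om t e].
Proof. by have [] := omP. Qed.

Lemma measurable_closed_in L : measurable [set t | closed_in (om t) [in L]].
Proof.
rewrite (_ : [set t | _] = \bigcap_(e in [set` L]) ~` [set t | om t e]).
  by apply: countable_bigcap_measurable => e _; apply/measurableC/measurable_open_edge.
by apply/seteqP; split=> t cl e /cl /=; [move=> -> | move=> /negP/negbTE].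
Qed.

Lemma measurable_large_exploration S m :
  measurable [set t | large_exploration (om t) S m].
Proof. by apply: countable_bigcup_measurable => c _; apply: measurable_closed_in. Qed.

Lemma measurable_open_adj x y : measurable [set t | open_adj (om t) x y].
Proof.
rewrite (_ : [set t | _] = \bigcup_(e in [set e | edge_joins e x y]) [set t | om t e]).
  by apply: countable_bigcup_measurable => e _; apply: measurable_open_edge.
by apply/seteqP; split=> t /open_adjP.
Qed.

Lemma measurable_path x s : measurable [set t | path (open_adj (om t)) x s].
Proof.
elim: s x => [|y s IHs] x /=; first by rewrite (_ : [set t | _] = setT) ?set_true.
rewrite (_ : [set t | _] = [set t | open_adj (om t) x y] `&`
                           [set t | path (open_adj (om t)) y s]).
  by apply: measurableI => //; apply: measurable_open_adj.
by apply/seteqP; split=> t /= /andP.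
Qed.

Lemma measurable_open_path x y n : measurable [set t | open_path (om t) x y n].
Proof.
rewrite (_ : [set t | _] = \bigcup_(s in [set s | size s = n /\ last x s = y])
    [set t | path (open_adj (om t)) x s]).
  by apply: countable_bigcup_measurable => s _; apply: measurable_path.
by apply/seteqP; split=> t [s] => [[? []]|[]]; exists s.
Qed.

Lemma measurable_joined x y : measurable [set t | joined (om t) x y].
Proof.
rewrite (_ : [set t | _] = \bigcup_n [set t | open_path (om t) x y n]).
  by apply: bigcupT_measurable => n; apply: measurable_open_path.
by apply/seteqP; split=> t [n]; exists n.
Qed.

Lemma chem_dist_geP (c : config d) x y (r : R) :
  (r%:E <= chem_dist R c x y)%E <-> forall n, n%:R < r -> ~ open_path c x y n.
Proof.
split=> [le_r n lt_nr pn|no_path].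
  have : (r%:E <= n%:R%:E)%E by apply: le_trans le_r _; apply: ereal_inf_lbound; exists n.
  by rewrite lee_fin leNgt lt_nr.
apply: le_ereal_inf_tmp => _ [n pn <-]; rewrite lee_fin leNgt.
by apply/negP => /no_path.
Qed.

Lemma measurable_chem_dist_ge x y (r : R) :
  measurable [set t | (r%:E <= chem_dist R (om t) x y)%E].
Proof.
rewrite (_ : [set t | _] = \bigcap_(n in [set n | n%:R < r]) ~` [set t | open_path (om t) x y n]).
  by apply: bigcap_measurableType => n _; apply/measurableC/measurable_open_path.
by apply/seteqP; split=> t /chem_dist_geP.
Qed.

Lemma percolatesP (c : config d) :
  percolates c <-> forall V : seq (vertex d), exists2 y, y \notin V & joined c (origin d) y.
Proof.
split=> [inf V|esc /finite_seqP[V clE]].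
  apply: contrapT => noesc; apply: inf; apply: (sub_finite_set (B := [set` V])) => // y jy.
  by apply: contrapT => /negP yV; apply: noesc; exists y.
have [y yV jy] := esc V; move/negP: yV; apply.
by have : [set` V] y by rewrite -clE.
Qed.

Lemma measurable_percolates : measurable [set t | percolates (om t)].
Proof.
rewrite (_ : [set t | _] = \bigcap_(V : seq (vertex d))
    \bigcup_(y in [set y | y \notin V]) [set t | joined (om t) (origin d) y]).
  apply: countable_bigcap_measurable => V _; apply: countable_bigcup_measurable => y _.
  exact: measurable_joined.
apply/seteqP; split=> t => [/percolatesP esc V _|esc]; first exact: esc.
by apply/percolatesP => V; apply: esc.
Qed.

Lemma prob_closed_in L : uniq L ->
  P [set t | closed_in (om t) [in L]] = ((1 - p) ^+ size L)%:E.
Proof.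
move=> uL; have [_ /(_ L (fun=> false) uL)] := omP.
by rewrite big_const_seq count_predT iter_mulr_1.
Qed.

Hypothesis p01 : 0 <= p <= 1.

Lemma prob_large_exploration S m :
  (P [set t | large_exploration (om t) S m] <=
   (2 ^+ size S * branching_rate d p ^+ m)%:E)%E.
Proof.
have /andP[q_ge0 q_le1] : 0 <= 1 - p <= 1 by case/andP: p01; lra.
pose D (c : code S m) := (m <= size (decode c))%N && uniq (decode c).
pose F (c : code S m) := [set t | closed_in (om t) [in decode c]].
apply: le_trans (measure_bigcup_fin_le P (D := D) (F := F) _) _.
  by move=> c _; apply: measurable_closed_in.
apply: (@le_trans _ _ (\sum_(c | D c) ((1 - p) ^+ m)%:E)%E).
  apply: lee_sum => c /andP[le_m uniq_c]; rewrite [leLHS](prob_closed_in uniq_c) lee_fin.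
  exact: ler_wiXn2l.
rewrite sumEFin lee_fin sumr_const exprMn mulrA -!natrX -natrM -card_code mulr_natl.
by rewrite ler_wpMn2l ?exprn_ge0 ?max_card.
Qed.

End Events.

(** * Exponential decay of the chemical distance *)

Section ShortDetours.
Variable d : nat.
Implicit Types (om : config d) (E K : seq (edge d)) (V : seq (vertex d)) (x y : vertex d).

Lemma open_path_detour om E V K x y :
    supported_on [in E] V -> x \in V -> joined [in E] x y ->
    closed_in om [in K] -> saturated om [in K] -> {in E, forall e, om e = false -> e \in K} ->
    joined om x y ->
  exists2 n, (n < size V + 2 * branching d * size K)%N & open_path om x y n.
Proof.
move=> EV xV jE clK satK EK jom.
have avoidK : joined (fun e => e \notin K) x y.
  by apply: joined_sub jom => e oe; apply: contraL oe => /clK ->.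
pose N := flatten (map (@nbrs d) K).
have nearN e : near_edges [in K] e -> e \in N.
  move=> /asboolP[e' e'K close]; apply/flattenP; exists (nbrs e'); last by rewrite mem_nbrs.
  exact: map_f.
have [||n lt_n pn] := open_path_short (V := V ++ map fst N ++ map (@head_of d) N) _ _
  (joined_detour clK satK EK jE avoidK); first by rewrite mem_cat xV.
  move=> e /andP[_ /orP[/EV[tV hV]|/nearN eN]]; rewrite !mem_cat.
    by rewrite tV hV.
  by rewrite !(map_f _ eN) !orbT.
exists n; last by apply: open_path_sub pn => e /andP[].
by move: lt_n; rewrite !size_cat !size_map size_flatten_nbrs; lia.
Qed.

Lemma open_path_small_exploration x : exists2 E, size E = norm1 x &
  forall om m, ~ large_exploration om E m.+1 -> joined om (origin d) x ->
  exists2 n, (n <= norm1 x + 2 * branching d * m)%N & open_path om (origin d) x n.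
Proof.
have [E [V [sE sV oV EV jE]]] := open_path_edges (open_path_norm1 x).
exists E => // om m small jom.
have [K [clK satK EK ltK _]] :=
  small_exploration (height := fun=> 0%N) (fun _ _ _ => isT) (fun _ _ => erefl) small.
have [n lt_n pn] := open_path_detour EV oV jE clK satK EK jom.
by exists n => //; move: lt_n; rewrite sV; nia.
Qed.

End ShortDetours.

Lemma exprn_le_invX (R : realFieldType) (x q : R) (k m n : nat) :
  1 <= x -> 0 <= q -> x ^+ k * q <= 1 -> (n <= k * m)%N -> q ^+ m <= x ^- n.
Proof.
move=> x_ge1 q_ge0 small le_n; have x_gt0 : 0 < x by apply: lt_le_trans x_ge1.
have le_q : q <= x ^- k by rewrite -[leRHS]div1r ler_pdivlMr ?exprn_gt0 // mulrC.
apply: (@le_trans _ _ (x ^- (k * m))); last first.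
  by rewrite lef_pV2 ?posrE ?exprn_gt0 // ler_weXn2l.
by rewrite exprM -exprVn; apply: lerXn2r; rewrite ?nnegrE ?invr_ge0 ?exprn_ge0 // ltW.
Qed.

Section Decay.
Variables (R : realType) (d : nat) (alpha p : R) (d0 : measure_display)
  (T : measurableType d0) (P : probability T R) (om : T -> config d).
Hypotheses (omP : bernoulli_bond p P om) (p01 : 0 <= p <= 1).

Definition stretched (c : config d) (x : vertex d) : Prop :=
  joined c (origin d) x /\
  (((1 + alpha) * (norm1 x)%:R)%:E <= chem_dist R c (origin d) x)%E.

Lemma measurable_stretched x : measurable [set t | stretched (om t) x].
Proof.
apply: measurableI; first exact: measurable_joined omP _ _.
exact: measurable_chem_dist_ge omP _ _ _.
Qed.

Lemma prob_stretched x m : (2 * branching d * m)%:R < alpha * (norm1 x)%:R ->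
  (P [set t | stretched (om t) x] <=
   (2 ^+ norm1 x * branching_rate d p ^+ m.+1)%:E)%E.
Proof.
move=> lt_m; have [E sE short_path] := open_path_small_exploration x.
rewrite -sE; apply: le_trans (prob_large_exploration omP p01 E m.+1).
apply: le_measure; rewrite ?inE.
- exact: measurable_stretched.
- exact: measurable_large_exploration omP _ _.
move=> t [jt /chem_dist_geP no_path]; apply: contrapT => /short_path /(_ jt)[n le_n].
apply: no_path; apply: (@le_lt_trans _ _ (norm1 x + 2 * branching d * m)%:R).
  by rewrite ler_nat.
by rewrite natrD mulrDl mul1r ltrD2l.
Qed.

Lemma stretched_decay k x : 0 < alpha -> (2 * branching d)%:R < alpha * k%:R ->
    4 ^+ k * branching_rate d p <= 1 -> (0 < norm1 x)%N ->
  (P [set t | stretched (om t) x] <= (expR (- ln 2 * (norm1 x)%:R))%:E)%E.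
Proof.
move=> alpha_gt0 lt_k small x_gt0.
have k_gt0 : (0 < k)%N.
  by rewrite lt0n; apply: contraTneq lt_k => ->; rewrite mulr0 -leNgt ler0n.
set n := norm1 x in x_gt0 *; pose m := (n %/ k)%N.
have /andP[le_mn lt_nm] : (m * k <= n < m.+1 * k)%N by rewrite leq_divM ltn_ceil.
have lt_m : (2 * branching d * m)%:R < alpha * n%:R.
  have [->|m_gt0] := posnP m; first by rewrite muln0 mulr_gt0 ?ltr0n.
  apply: (@lt_le_trans _ _ (alpha * (m * k)%:R)); last by rewrite ler_pM2l // ler_nat.
  by rewrite natrM [(m * k)%:R]natrM [m%:R * _]mulrC mulrA ltr_pM2r ?ltr0n.
apply: le_trans (prob_stretched lt_m) _; rewrite lee_fin -/n.
have rate_pow : branching_rate d p ^+ m.+1 <= 4 ^- n.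
  apply: exprn_le_invX small _; rewrite ?ler1n ?branching_rate_ge0 //.
  by rewrite mulnC ltnW.
apply: le_trans (ler_wpM2l _ rate_pow) _; first exact: exprn_ge0.
have -> : 4 ^+ n = 2 ^+ n * 2 ^+ n :> R by rewrite -exprMn -natrM.
by rewrite mulNr expRN expRM_natr lnK ?posrE // invfM mulrA divff ?mul1r // expf_neq0.
Qed.

End Decay.

(** * Percolation near p = 1 *)

Lemma sum_geometric_le (R : realFieldType) (q : R) (n : nat) :
  0 <= q < 1 -> \sum_(k < n) q ^+ k.+1 <= q / (1 - q).
Proof.
move=> /andP[q_ge0 q_lt1]; rewrite ler_pdivlMr ?subr_gt0 // mulrC.
under eq_bigr do rewrite exprS.
rewrite -mulr_sumr mulrCA -opprB mulNr -subrX1 opprB ler_piMr //.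
by rewrite gerBl exprn_ge0.
Qed.

Section Crossing.
Variables (d : nat) (i0 i1 : 'I_d).
Hypothesis neq01 : i1 != i0.
Implicit Types (n k : nat) (e : edge d).

Definition axis_point n : vertex d := shift (origin d) i0 n%:Z.

Lemma axis_point_i0 n : axis_point n i0 = n%:Z.
Proof. by rewrite shift_same ffunE add0r. Qed.

Lemma axis_point_i1 n : axis_point n i1 = 0.
Proof. by rewrite shift_other // ffunE. Qed.

Definition axis_edge k : edge d := (axis_point k, i0).

Definition axis_dist k e : nat := maxn `|(e.1 i0 - k%:Z)%R| `|e.1 i1|.

Definition square_sides n : config d :=
  fun e => [|| e.1 i0 == 0, e.1 i0 == n%:Z | e.1 i1 == n%:Z].

Definition clearance n k : nat := minn k.+1 (n - k).

Lemma axis_dist_close k e e' : close_edges e e' -> (axis_dist k e' <= (axis_dist k e).+1)%N.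
Proof.
move=> /forallP close; have := close i0; have := close i1.
rewrite /axis_dist; move: (e.1 i0) (e.1 i1) (e'.1 i0) (e'.1 i1); lia.
Qed.

Lemma axis_dist_edge k : axis_dist k (axis_edge k) = 0%N.
Proof. by rewrite /axis_dist /= axis_point_i0 axis_point_i1 subrr. Qed.

Lemma clearance_avoids_sides n k e :
  ((axis_dist k e).+1 < clearance n k)%N -> ~~ square_sides n e.
Proof.
rewrite /axis_dist /clearance => clear; apply/negP.
by move: clear => /[swap] /or3P[] /eqP ->; lia.
Qed.

Lemma joined_square_sides n : joined (square_sides n) (origin d) (axis_point n).
Proof.
have neq10 : i0 != i1 by rewrite eq_sym.
pose corner := shift (origin d) i1 n%:Z.
have corner_i1 : corner i1 = n%:Z by rewrite shift_same ffunE add0r.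
apply: (@joined_trans _ _ corner).
  apply: joined_line => k _.
  by rewrite /square_sides /= (shift_other _ _ neq10) ffunE eqxx.
apply: (@joined_trans _ _ (shift corner i0 n%:Z)).
  apply: joined_line => k _.
  by rewrite /square_sides /= (shift_other _ _ neq01) corner_i1 eqxx !orbT.
rewrite /corner shiftC; apply/joined_sym/joined_line => k _.
by rewrite /square_sides /= (shift_other _ _ neq10) axis_point_i0 eqxx orbT.
Qed.

Lemma joined_axis (om : config d) n :
  (forall k, (k < n)%N -> ~ large_exploration om [:: axis_edge k] (clearance n k)) ->
  joined om (origin d) (axis_point n).
Proof.
move=> small; pose axis e := `[< exists2 k, (k < n)%N & e = axis_edge k >].
have jaxis : joined axis (origin d) (axis_point n).
  by apply: joined_line => k ltkn; apply/asboolP; exists k.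
apply: joined_bypass jaxis (joined_square_sides n).
move=> _ /asboolP[k ltkn ->] closed_k.
have [|K [clK satK axisK ltK distK]] := small_exploration (@axis_dist_close k) _ (small k ltkn).
  by move=> e; rewrite inE => /eqP ->; apply: axis_dist_edge.
exists [in K]; split=> //; first by apply: axisK closed_k; apply: mem_head.
by move=> e /distK lt_e; apply: (@clearance_avoids_sides n k); apply: leq_ltn_trans lt_e ltK.
Qed.

Section Probability.
Variables (R : realType) (p : R) (d0 : measure_display)
  (T : measurableType d0) (P : probability T R) (om : T -> config d).
Hypotheses (omP : bernoulli_bond p P om) (p01 : 0 <= p <= 1).

Let q : R := branching_rate d p.
Hypothesis q_lt1 : q < 1.

Lemma prob_joined_axis n :
  ((1 - 4 * (q / (1 - q)))%:E <= P [set t | joined (om t) (origin d) (axis_point n)])%E.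
Proof.
have q_ge0 : 0 <= q by apply: branching_rate_ge0.
set J := [set t | _].
pose B k := [set t | large_exploration (om t) [:: axis_edge k] (clearance n k)].
have mB k : measurable (B k) by apply: measurable_large_exploration omP _ _.
have mJ : measurable J := measurable_joined omP (origin d) (axis_point n).
have sub_B : ~` J `<=` \big[setU/set0]_(k < n) B k.
  move=> t /= nJ; rewrite -bigcup_mkord; apply: contrapT => nB; apply: nJ.
  by apply: joined_axis => k ltkn large; apply: nB; exists k.
have le_B (k : 'I_n) : (P (B k) <= (2 * (q ^+ k.+1 + q ^+ (n - k)))%:E)%E.
  apply: le_trans (prob_large_exploration omP p01 _ _) _.
  rewrite lee_fin expr1 ler_pM2l // -/q /clearance.
  by rewrite /minn; case: ifP => _; rewrite ?lerDl ?lerDr exprn_ge0.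
have : (P (~` J) <= (4 * (q / (1 - q)))%:E)%E.
  apply: (@le_trans _ _ (P (\big[setU/set0]_(k < n) B k))).
    apply: le_measure sub_B; rewrite inE; first exact: measurableC.
    exact: bigsetU_measurable.
  apply: le_trans (Boole_inequality P (fun k _ => mB k)) _.
  apply: (@le_trans _ _ (\sum_(k < n) (2 * (q ^+ k.+1 + q ^+ (n - k)))%:E)%E).
    by apply: lee_sum => k _; apply: le_B.
  rewrite sumEFin lee_fin -mulr_sumr big_split /=.
  rewrite [X in _ + X](reindex_inj rev_ord_inj) /=.
  under [X in _ + X]eq_bigr do rewrite subKn //.
  have := @sum_geometric_le _ q n; rewrite q_ge0 q_lt1 => /(_ isT).
  by move: (\sum_(k < n) _) (q / _) => s r; lra.
rewrite probability_setC //.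
have : P J \is a fin_num by rewrite fin_num_measure.
by case: (P J) => // r _; rewrite -EFinB !lee_fin; lra.
Qed.

Lemma prob_percolates :
  ((1 - 4 * (q / (1 - q)))%:E <= P [set t | percolates (om t)])%E.
Proof.
pose J n := [set t | joined (om t) (origin d) (axis_point n)].
have mJ n : measurable (J n) by apply: measurable_joined omP _ _.
apply: le_trans (le_probability_lim_sup_set mJ prob_joined_axis) _.
apply: le_measure; rewrite ?inE.
- by apply: bigcap_measurableType => n _; apply: bigcup_measurable => k _; apply: mJ.
- exact: measurable_percolates omP.
move=> t limJ; apply/percolatesP => V.
have [n /= lt_n jn] := limJ (\max_(y <- V) `|y i0|).+1 I.
exists (axis_point n) => //; apply: contraL lt_n => nV; rewrite -leqNgt.
have := @leq_bigmax_seq _ _ xpredT (fun y : vertex d => `|y i0|%N) _ nV isT.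
by rewrite axis_point_i0.
Qed.

End Probability.
End Crossing.

(** * A realization of Bernoulli percolation *)

Section Digits.
Variables (R : realType) (p : R).
Hypothesis p01 : 0 <= p <= 1.
Implicit Types (t l r : R) (b : bool) (c : seq (option bool)).

Definition weight b : R := if b then p else 1 - p.

Definition offset b : R := if b then 0 else p.

(* For [p = 0] or [p = 1] the division by [0] only occurs outside [0, 1). *)
Definition cut t : R := (t - offset (t < p)) / weight (t < p).

(* The digits of [t] in the expansion obtained by repeatedly cutting an interval in
   proportions [p] and [1 - p]. *)
Definition digit (n : nat) t : bool := iter n cut t < p.

Lemma weight_ge0 b : 0 <= weight b.
Proof. by rewrite /weight; case: b; case/andP: p01; lra. Qed.

Lemma measurable_cut : measurable_fun setT (cut : measurableTypeR R -> measurableTypeR R).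
Proof.
rewrite (_ : cut = fun t => if t < p then t / p else (t - p) / (1 - p)).
  apply: measurable_fun_ifT; first exact: measurable_fun_ltr.
    by apply: measurable_funM.
  by apply: measurable_funM => //; apply: measurable_funB.
by apply/funext => t; rewrite /cut /offset /weight; case: ifP; rewrite ?subr0.
Qed.

Lemma measurable_digit n : measurable_fun setT (digit n : measurableTypeR R -> bool).
Proof.
apply: measurable_fun_ltr => //; elim: n => [|n IHn] /=; first exact: measurable_id.
exact: measurableT_comp measurable_cut IHn.
Qed.

Lemma measurable_digit_eq n b : measurable (digit n @^-1` [set b] : set (measurableTypeR R)).
Proof. by rewrite -[X in measurable X]setTI; apply: measurable_digit. Qed.

Lemma first_digit_itv b t :
  (offset b <= t < offset b + weight b) = (0 <= t < 1) && ((t < p) == b).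
Proof.
case/andP: p01 => p_ge0 p_le1; rewrite /offset /weight; case: b.
  by rewrite eqb_id add0r; apply/andP/andP => [[? ?]|[/andP[? ?] ?]]; split; lra.
rewrite eqbF_neg -leNgt addrC subrK.
by apply/andP/andP => [[? ?]|[/andP[? ?] ?]]; split; lra.
Qed.

Lemma cut_itv b l r t : 0 <= l -> r <= 1 ->
  (offset b + weight b * l <= t < offset b + weight b * r) =
  [&& 0 <= t < 1, (t < p) == b & l <= cut t < r].
Proof.
move=> l_ge0 r_le1; rewrite andbA -first_digit_itv.
have := weight_ge0 b; rewrite le_eqVlt => /orP[/eqP <-|w_gt0].
  by rewrite !mul0r !addr0 !le_lt_asym.
have wl_ge0 : 0 <= weight b * l by rewrite mulr_ge0 // ltW.
have wr_le : weight b * r <= weight b by rewrite ler_piMr // ltW.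
have cutE : (0 <= t < 1) && ((t < p) == b) ->
    (l <= cut t < r) = (offset b + weight b * l <= t < offset b + weight b * r).
  move=> /andP[_ /eqP tb]; rewrite /cut tb ler_pdivlMr // ltr_pdivrMr //.
  by rewrite ![_ * weight b]mulrC lerBrDl ltrBlDl.
apply/idP/andP => [in_lr|[]]; last by rewrite first_digit_itv => /cutE ->.
have in_b : offset b <= t < offset b + weight b by case/andP: in_lr; lra.
by split=> //; rewrite cutE // -first_digit_itv.
Qed.

Definition cylinder c : set (measurableTypeR R) :=
  [set t | 0 <= t < 1 /\ forall i b, nth None c i = Some b -> digit i t = b].

Lemma measurable_cylinder c : measurable (cylinder c).
Proof.
rewrite (_ : cylinder c = `[0, 1[%classic `&`
    \bigcap_i \bigcap_(b in [set b | nth None c i = Some b]) (digit i @^-1` [set b])).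
  apply: measurableI; first exact: measurable_itv.
  apply: bigcap_measurableType => i _; apply: countable_bigcap_measurable => b _.
  exact: measurable_digit_eq.
apply/seteqP; split=> t /=; rewrite in_itv /=; case=> t01 tc.
  by split=> // i _ b /tc.
by split=> // i b /(tc i I).
Qed.

Lemma cylinder_cons b c :
  cylinder (Some b :: c) = [set t | [/\ 0 <= t < 1, (t < p) = b & cylinder c (cut t)]].
Proof.
have cut01 t : 0 <= t < 1 -> (t < p) = b -> 0 <= cut t < 1.
  move=> t01 tb; have := @cut_itv b 0 1 t (lexx _) (lexx _).
  by rewrite mulr0 addr0 mulr1 first_digit_itv t01 tb eqxx.
apply/seteqP; split=> t [] /= => [t01 tc|t01 tb [_ tc]].
  have tb : (t < p) = b := tc 0%N b erefl.
  split=> //; split=> [|i b' ci]; first exact: cut01.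
  by rewrite -(tc i.+1 b' ci) /digit iterSr.
by split=> // -[b' [<-] //|i b' ci]; rewrite /digit iterSr; apply: tc.
Qed.

Fixpoint cylinder_left (s : seq bool) : R :=
  if s is b :: s' then offset b + weight b * cylinder_left s' else 0.

Definition cylinder_width (s : seq bool) : R := \prod_(b <- s) weight b.

Lemma cylinder_width_ge0 s : 0 <= cylinder_width s.
Proof. by apply: prodr_ge0 => b _; apply: weight_ge0. Qed.

Lemma cylinder_left_ge0 s : 0 <= cylinder_left s.
Proof.
elim: s => //= b s IHs; apply: addr_ge0; last exact: mulr_ge0 (weight_ge0 b) IHs.
by rewrite /offset; case: b => //; case/andP: p01.
Qed.

Lemma cylinder_right_cons b s : cylinder_left (b :: s) + cylinder_width (b :: s) =
  offset b + weight b * (cylinder_left s + cylinder_width s).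
Proof. by rewrite /cylinder_width big_cons /= mulrDr addrA. Qed.

Lemma cylinder_right_le1 s : cylinder_left s + cylinder_width s <= 1.
Proof.
elim: s => [|b s IHs]; first by rewrite /cylinder_width big_nil add0r.
rewrite cylinder_right_cons; apply: le_trans (lerD (lexx _) (ler_wpM2l (weight_ge0 b) IHs)) _.
by rewrite mulr1 /offset /weight; case: b; case/andP: p01; lra.
Qed.

Lemma cylinder_itv s : cylinder (map Some s) =
  `[cylinder_left s, cylinder_left s + cylinder_width s[%classic.
Proof.
elim: s => [|b s IHs].
  rewrite /cylinder_width big_nil add0r; apply/seteqP; split=> t /=; rewrite in_itv /=.
    by case.
  by split=> // i b; rewrite nth_nil.
rewrite /= cylinder_cons IHs cylinder_right_cons; apply/seteqP; split=> t /=;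
  rewrite !in_itv /= cut_itv ?cylinder_left_ge0 ?cylinder_right_le1 //.
  by case=> -> -> ->; rewrite eqxx.
by case/and3P=> -> /eqP.
Qed.

Let U : probability (measurableTypeR R) R := uniform_prob (@ltr01 R).

Lemma uniform_prob_sub (A : set (measurableTypeR R)) : measurable A ->
  A `<=` `[0, 1]%classic -> U A = lebesgue_measure A.
Proof.
move=> mA sA; rewrite /U /= /uniform_prob (eq_integral (fun=> 1%E)).
  by rewrite integral_cst //= mul1e.
move=> t; rewrite inE => /sA /=; rewrite in_itv /= /uniform_pdf => ->.
by rewrite subr0 invr1.
Qed.

Lemma prob_cylinder_bits s : U (cylinder (map Some s)) = (cylinder_width s)%:E.
Proof.
rewrite uniform_prob_sub; last 2 first.
- exact: measurable_cylinder.
- by move=> t [/andP[t_ge0 t_lt1] _] /=; rewrite in_itv /= t_ge0 ltW.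
rewrite cylinder_itv lebesgue_measure_itv /= lte_fin ltrDl -EFinB [_ + _ - _]addrC addKr.
have := cylinder_width_ge0 s; rewrite le_eqVlt => /orP[/eqP <-|->//].
by rewrite ltxx.
Qed.

Lemma cylinder_cat_Some (s c : seq (option bool)) b :
  cylinder (s ++ Some b :: c) = cylinder (s ++ None :: c) `&` (digit (size s) @^-1` [set b]).
Proof.
have nth_mid o i : nth None (s ++ o :: c) i =
    if i == size s then o else nth None (s ++ None :: c) i.
  by rewrite !nth_cat; case: ltngtP => // [lt|->]; rewrite ?subnn // -[(i - _)%N]prednK ?subn_gt0.
apply/seteqP; split=> t /=.
  move=> [t01 tc]; split; first split=> // i b'.
    by rewrite nth_mid; case: eqP => // /eqP nei ci; apply: tc; rewrite nth_mid (negbTE nei).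
  by apply: tc; rewrite nth_mid eqxx.
move=> [[t01 tc] tb]; split=> // i b'; rewrite nth_mid; case: eqP => [-> [<-]//|_].
exact: tc.
Qed.

Lemma prob_cylinder (s : seq bool) c :
  U (cylinder (map Some s ++ c)) = (cylinder_width s * \prod_(o <- c) oapp weight 1 o)%:E.
Proof.
elim: c s => [|[b|] c IHc] s.
- by rewrite cats0 prob_cylinder_bits big_nil mulr1.
- rewrite -cat_rcons -map_rcons IHc /cylinder_width big_rcons big_cons /=.
  by congr EFin; ring.
pose A := cylinder (map Some s ++ None :: c); pose D b := digit (size s) @^-1` [set b].
have prob_AD b : U (A `&` D b) = (cylinder_width s * weight b * \prod_(o <- c) oapp weight 1 o)%:E.
  rewrite /A /D -(size_map Some s) -cylinder_cat_Some -cat_rcons -map_rcons IHc.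
  by rewrite /cylinder_width big_rcons.
have ADfalse : A `\` D true = A `&` D false.
  by rewrite setDE; congr (_ `&` _); apply/seteqP; split=> t; rewrite /D /=; case: (digit _ t).
rewrite [LHS](measureDI U (measurable_cylinder _) (measurable_digit_eq (size s) true)).
rewrite -/A -/(D true) ADfalse [X in (X + _)%E = _]prob_AD [X in (_ + X)%E = _]prob_AD.
rewrite -EFinD big_cons /=.
by congr EFin; rewrite /weight; ring.
Qed.

Lemma digits_iid (J : seq nat) (b : nat -> bool) : uniq J ->
  U [set t | forall i, i \in J -> digit i t = b i] = (\prod_(i <- J) weight (b i))%:E.
Proof.
move=> uJ; pose N := (\max_(i <- J) i).+1.
have ltN i : i \in J -> (i < N)%N.
  by move=> iJ; rewrite ltnS; apply: (@leq_bigmax_seq _ _ xpredT id).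
pose c := [seq if i \in J then Some (b i) else None | i <- iota 0 N].
have nth_c i : nth None c i = if i \in J then Some (b i) else None.
  have [ltiN|leNi] := ltnP i N; first by rewrite (nth_map 0%N) ?size_iota // nth_iota.
  rewrite nth_default ?size_map ?size_iota //.
  by case: ifP => // /ltN; rewrite ltnNge leNi.
pose E := [set t : measurableTypeR R | forall i, i \in J -> digit i t = b i].
have mE : measurable E.
  rewrite (_ : E = \bigcap_(i in [set` J]) digit i @^-1` [set b i]) //.
  by apply: bigcap_measurableType => i _; apply: measurable_digit_eq.
have U01 : U (cylinder [::]) = 1%E.
  by rewrite (prob_cylinder_bits [::]) /cylinder_width big_nil.
rewrite -(probability_setI1 (measurable_cylinder _) mE U01).
have -> : E `&` cylinder [::] = cylinder (map Some [::] ++ c).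
  apply/seteqP; split=> t /=.
    move=> [tE [t01 _]]; split=> // i b'; rewrite nth_c.
    by case: ifP => // iJ [<-]; apply: tE.
  move=> [t01 tc]; split; last by split=> // i b'; rewrite nth_nil.
  by move=> i iJ; apply: tc; rewrite nth_c iJ.
rewrite prob_cylinder /cylinder_width big_nil mul1r big_map; congr EFin.
under eq_bigr do rewrite (fun_if (oapp weight 1)) /=.
rewrite -big_mkcond -big_filter; apply: perm_big; apply: uniq_perm => //.
  exact/filter_uniq/iota_uniq.
by move=> i; rewrite mem_filter mem_iota /=; apply/andP/idP => [[]//|iJ]; rewrite iJ ltN.
Qed.

End Digits.

Lemma bernoulli_bond_exists (R : realType) (p : R) d : 0 <= p <= 1 ->
  exists om : measurableTypeR R -> config d, bernoulli_bond p (uniform_prob (@ltr01 R)) om.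
Proof.
move=> p01; exists (fun t e => digit p (pickle e) t); split=> [e|F a uF].
  exact: (measurable_digit_eq p (pickle e) true).
pose b i := oapp a false (unpickle i).
have uJ : uniq (map pickle F) by rewrite map_inj_uniq //; exact: pcan_inj pickleK.
have := digits_iid p01 b uJ; rewrite big_map.
under eq_bigr do rewrite /b pickleK /=.
move=> <-; congr (_ _); apply/seteqP; split=> t /= tF.
  by move=> _ /mapP[e eF ->]; rewrite /b pickleK tF.
by move=> e eF; rewrite tF ?map_f // /b pickleK.
Qed.

(** * The critical probability and the theorem *)

Lemma ltr_1BVX (R : realFieldType) (x y : R) (n : nat) : 0 < x ->
  (1 - x ^- n < y) = (x ^+ n * (1 - y) < 1).
Proof. by move=> x_gt0; rewrite mulrC -ltr_pdivlMr ?exprn_gt0 // div1r ltrBlDr ltrBlDl addrC. Qed.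

Lemma subr_1VX_ge0 (R : realFieldType) (x : R) (n : nat) : 1 <= x -> 0 <= 1 - x ^- n.
Proof.
move=> x_ge1; rewrite subr_ge0 invf_le1 ?exprn_ege1 // exprn_gt0 //.
exact: lt_le_trans x_ge1.
Qed.

Lemma no_percolation_le (R : realType) (d : nat) (p : R) : (2 <= d)%N ->
  0 <= p <= 1 -> no_percolation d p -> p <= 1 - 2 ^- (branching d + 3).
Proof.
move=> d_ge2 p01 no_perc; rewrite leNgt ltr_1BVX // exprD mulrAC; apply/negP.
have -> : 2 ^+ 3 = 8 :> R by rewrite -natrX.
have := branching_rate_ge0 d p01; rewrite -/(branching_rate d p).
set q := branching_rate d p => q_ge0 q_small.
have q_lt1 : q < 1 by lra.
have neq01 : Ordinal d_ge2 != Ordinal (ltnW d_ge2) by [].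
have [om omP] := bernoulli_bond_exists d p01.
have := prob_percolates neq01 omP p01 q_lt1; rewrite (no_perc _ _ _ _ omP) lee_fin -/q.
apply/negP; rewrite -ltNge subr_gt0 mulrA ltr_pdivrMr ?subr_gt0 //; lra.
Qed.

Lemma p_c_le (R : realType) (d : nat) : (2 <= d)%N ->
  p_c R d <= 1 - 2 ^- (branching d + 3).
Proof.
move=> d_ge2; rewrite /p_c; set A := [set p | _].
have [->|/set0P A_neq0] := eqVneq A set0.
  by rewrite sup0 subr_1VX_ge0 ?ler1n.
by apply: ge_sup => // p [p01]; apply: no_percolation_le.
Qed.

Theorem theorem1p4 (R : realType) (d : nat) :
  (2 <= d)%N ->
  forall alpha : R, 0 < alpha ->
  exists p' : R, p_c R d < p' /\ p' < 1 /\
    forall p : R, p' < p <= 1 ->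
    forall (d0 : measure_display) (T : measurableType d0) (P : probability T R)
      (om : T -> config d),
    bernoulli_bond p P om ->
    (* limsup_{||x||_1 -> oo} ln P(0 <-> x, D(0,x) >= (1+alpha)||x||_1) / ||x||_1 < 0 *)
    exists c : R, 0 < c /\ exists N : nat, forall x : vertex d, (N <= norm1 x)%N ->
      (P [set t | joined (om t) (origin d) x /\
                 (((1 + alpha) * (norm1 x)%:R)%:E <= chem_dist R (om t) (origin d) x)%E]
      <= (expR (- c * (norm1 x)%:R))%:E)%E.
Proof.
move=> d_ge2 alpha alpha_gt0; pose B := branching d.
pose k := Num.bound ((2 * B)%:R / alpha).
have lt_k : (2 * B)%:R < alpha * k%:R.
  by rewrite mulrC -ltr_pdivrMr //; apply: archi_boundP; rewrite divr_ge0 // ltW.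
exists (1 - 2 ^- (B + 2 * k + 4)); split; [|split].
- apply: le_lt_trans (p_c_le R d_ge2) _; rewrite ltrD2l ltrN2 ltf_pV2 ?posrE ?exprn_gt0 //.
  by rewrite ltr_eXn2l ?ltr1n // -/B; lia.
- by rewrite gtrBl invr_gt0 exprn_gt0.
move=> p /andP[gt_p p_le1] d0 T P om omP; exists (ln 2); split; first by rewrite ln_gt0 // ltr1n.
have p01 : 0 <= p <= 1 by rewrite p_le1 andbT (le_trans _ (ltW gt_p)) ?subr_1VX_ge0 ?ler1n.
have small : 4 ^+ k * branching_rate d p <= 1.
  have -> : 4 ^+ k = 2 ^+ (2 * k) :> R by rewrite exprM expr2 -natrM.
  rewrite ltr_1BVX // in gt_p; apply: le_trans (ltW gt_p); rewrite mulrA -exprD.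
  by rewrite ler_wpM2r ?subr_ge0 // ler_weXn2l ?ler1n //; lia.
by exists 1%N => x; exact: (stretched_decay omP p01 alpha_gt0 lt_k small).
Qed.
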